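(* Let $A,B\subseteq\mathbb{Z}$ be finite sets with $|A|\ge 5$ and $|B|\ge 2$. Then $|A\widehat{+}B|=|A|+|B|-3$ if and only if $A=B$ and there exist $\tau,d\in\mathbb{Z}$ with $d\neq 0$ such that $A=\{\tau+id: i=0,1,\dots,|A|-1\}$.
   Context: For finite sets $A,B\subseteq\mathbb{Z}$, the restricted sumset is $A\widehat{+}B=\{a+b: a\in A,\ b\in B,\ a\neq b\}$. A pair with $|A\widehat{+}B|=|A|+|B|-3$ is called a critical pair; a set of the form $\{\tau+id: i=0,\dots,|A|-1\}$ with $d\ne0$ is a standard set, and $(A,B)$ is a standard pair if $A=B$ is a standard set. Throughout the paper all sets considered have at least two elements. *)

(* Defs.v *)
From mathcomp Require Import all_boot all_order all_algebra.
From mathcomp Require Import finmap.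

Set Implicit Arguments.
Unset Strict Implicit.
Unset Printing Implicit Defensive.

Import GRing.Theory.

Local Open Scope fset_scope.
Local Open Scope ring_scope.

Definition restricted_sumset (A B : {fset int}) : {fset int} :=
  [fset a + b | a in A, b in [fset b in B | a != b]].

Definition arith_prog (t d : int) (n : nat) : {fset int} :=
  [fset t + i%:Z * d | i in iota 0 n].

Lemma restricted_sumsetP (A B : {fset int}) (x : int) :
  reflect (exists a b, [/\ a \in A, b \in B, a != b & x = a + b])
          (x \in restricted_sumset A B).
Proof.
apply: (iffP (imfset2P _ _ _ _ _)) => /=.
  move=> [a aA [b]]; rewrite !inE => /andP[bB ab] ->.
  by exists a, b.
move=> [a [b [aA bB ab ->]]]; exists a => //.
by exists b => //; rewrite !inE bB.
Qed.

Lemma arith_progP (t d : int) (n : nat) (x : int) :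
  reflect (exists2 i : nat, (i < n)%N & x = t + i%:Z * d)
          (x \in arith_prog t d n).
Proof.
apply: (iffP (imfsetP _ _ _ _)) => /= -[i].
  by rewrite mem_iota add0n => ltin ->; exists i.
by move=> ltin ->; exists i; rewrite ?mem_iota.
Qed.

(* Main.v *)
Require Import Defs.
From mathcomp Require Import all_boot all_order all_algebra.
From mathcomp Require Import finmap zify.

Import GRing.Theory.

Local Open Scope fset_scope.

(** Let [t = min A] and [M = max B].  The "hook" [(t + B) U (A + M)] has
    [|A| + |B| - 1] elements, and at most two of them, [t + t] and [M + M], are
    not restricted sums.  Hence a critical pair has [t \in B], [M \in A], and its
    restricted sumset is exactly the hook minus these two points.  Exchanging
    [A] and [B] shows that both sets have the same minimum and maximum, and
    comparing the two hooks gives [A = B].  Now distinct [x, y \in A] satisfy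
    [x + y - t \in A] or [x + y - M \in A]: modulo [M - t], the set [A - t] is
    closed under sums of distinct elements.  If [a < b] are the two smallest
    elements of [A] above [t] and [d = a - t], this forces [M - d] to be the
    second largest element; adding [b] to it, which is licit because [5 <= |A|]
    makes them distinct, yields [b - d \in A], so [b = t + 2d].  Then [A] is
    closed under adding [d] below [M], and is a progression. *)

Lemma fset_int_min (A : {fset int}) : A != fset0 ->
  exists2 x, x \in A & forall y, y \in A -> (x <= y)%R.
Proof.
move=> /fset0Pn[x0 x0A].
case: (Order.TotalTheory.arg_minP (i0 := [` x0A]) (P := xpredT)
         (fun x : A => val x)) => // x _ xmin.
by exists (val x) => [|y yA]; [exact: valP | exact: (xmin [` yA])].
Qed.

Lemma fset_int_max (A : {fset int}) : A != fset0 ->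
  exists2 x, x \in A & forall y, y \in A -> (y <= x)%R.
Proof.
move=> /fset0Pn[x0 x0A].
case: (Order.TotalTheory.arg_maxP (i0 := [` x0A]) (P := xpredT)
         (fun x : A => val x)) => // x _ xmax.
by exists (val x) => [|y yA]; [exact: valP | exact: (xmax [` yA])].
Qed.

Lemma restricted_sumsetC (A B : {fset int}) :
  restricted_sumset A B = restricted_sumset B A.
Proof.
apply/fsetP => x; apply/restricted_sumsetP/restricted_sumsetP.
  by move=> [a [b [aA bB ab ->]]]; exists b, a; split=> //; [rewrite eq_sym | lia].
by move=> [a [b [aA bB ab ->]]]; exists b, a; split=> //; [rewrite eq_sym | lia].
Qed.

Lemma card_arith_prog (t d : int) (n : nat) : d <> 0%R ->
  #|` arith_prog t d n| = n.
Proof.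
move=> d0; rewrite card_imfset /=; first by rewrite undup_id ?iota_uniq ?size_iota.
by move=> i j /= /addrI /mulIf; case/(_ (introN eqP d0)).
Qed.

(** Sums of two distinct indices below [n] fill the interval from 1 to [2n - 3]; the shift by [d] in
    the base point makes index 1 the origin. *)
Lemma restricted_sumset_arith_prog (t d : int) (n : nat) : d <> 0%R -> (1 < n)%N ->
  restricted_sumset (arith_prog t d n) (arith_prog t d n) =
  arith_prog (t + t + d) d (n + n - 3).
Proof.
move=> d0 n1; apply/fsetP => x.
apply/restricted_sumsetP/arith_progP.
  move=> [_ [_ [/arith_progP[i ilt ->] /arith_progP[j jlt ->] ij ->]]].
  have neij : i <> j by move=> eij; rewrite eij eqxx in ij.
  exists (i + j - 1)%N; first by lia.
  have -> : ((i + j - 1)%N : int) = (i%:Z + j%:Z - 1)%R by lia.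
  lia.
move=> [k klt ->].
(* The index sum [k + 1] is split as [0 + (k + 1)] while this fits below [n], and otherwise with the
   last index [n - 1] as one summand. *)
have [kn|kn] := leqP k (n - 2).
  exists t, (t + k.+1%:Z * d)%R; split.
  - by apply/arith_progP; exists 0%N; lia.
  - by apply/arith_progP; exists k.+1 => //; lia.
  - by apply/eqP; nia.
  - lia.
exists (t + (k.+1 - (n - 1))%N%:Z * d)%R, (t + (n - 1)%N%:Z * d)%R; split.
- by apply/arith_progP; exists (k.+1 - (n - 1))%N => //; lia.
- by apply/arith_progP; exists (n - 1)%N => //; lia.
- apply/eqP => /addrI /mulIf; case/(_ (introN eqP d0)); lia.
- have -> : ((k.+1 - (n - 1))%N : int) = (k%:Z + 1 - (n - 1)%N%:Z)%R by lia.
  lia.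
Qed.

Lemma critical_hook (A B : {fset int}) (a M : int) :
    a \in A -> (forall x, x \in A -> (a <= x)%R) ->
    M \in B -> (forall x, x \in B -> (x <= M)%R) ->
    (2 <= #|` A|)%N -> (2 <= #|` B|)%N ->
    #|` restricted_sumset A B| = (#|` A| + #|` B| - 3)%N ->
  [/\ a \in B, M \in A &
      forall s, s \in restricted_sumset A B ->
        (s - a)%R \in B \/ (s - M)%R \in A].
Proof.
move=> aA amin MB Mmax hA hB crit.
set S := restricted_sumset A B in crit *.
pose HB : {fset int} := [fset (a + b)%R | b in B].
pose HA : {fset int} := [fset (x + M)%R | x in A].
pose U : {fset int} := HB `|` HA.
have cHB : #|` HB| = #|` B| by rewrite card_imfset //; apply: addrI.
have cHA : #|` HA| = #|` A| by rewrite card_imfset //; apply: addIr.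
(* If [a + b = x + M] with [a <= x] and [b <= M], both are equalities: the two arms meet at most in
   [a + M]. *)
have cHI : (#|` HB `&` HA| <= 1)%N.
  rewrite -(cardfs1 (a + M)%R); apply: fsubset_leq_card.
  apply/fsubsetP => s; rewrite !inE => /andP[/imfsetP[b /= bB ->]].
  move=> /imfsetP[x /= xA e]; have := amin _ xA; have := Mmax _ bB.
  by move=> *; apply/eqP; lia.
have cU : (#|` A| + #|` B| - 1 <= #|` U|)%N.
  by have := cardfsUI HB HA; rewrite cHB cHA -/U => e; lia.
(* By criticality [S] has at least two elements fewer than [U], so one extra point cannot complete a
   cover of [U]. *)
have cUS (X : {fset int}) : U `<=` S `|` X -> (2 <= #|` X|)%N.
  move=> /fsubset_leq_card cX.
  by have := cardfsUI S X => e; lia.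
have HBS b : b \in B -> b != a -> (a + b)%R \in S.
  by move=> bB ba; apply/restricted_sumsetP; exists a, b; rewrite eq_sym.
have HAS x : x \in A -> x != M -> (x + M)%R \in S.
  by move=> xA xM; apply/restricted_sumsetP; exists x, M.
(* Were [a] not in [B], every [a + b] would be a restricted sum and only [M + M] could be missing
   from [S]. *)
have aB : a \in B.
  apply/negPn/negP => aNB.
  have /cUS : U `<=` S `|` [fset (M + M)%R]; last by rewrite cardfs1.
  apply/fsubsetP => s; rewrite !inE => /orP[] /imfsetP[x /= xX ->].
    by rewrite HBS //; apply: contraNneq aNB => <-.
  by case: (eqVneq x M) => [->|xM]; rewrite ?eqxx ?orbT // HAS.
have MA : M \in A.
  apply/negPn/negP => MNA.
  have /cUS : U `<=` S `|` [fset (a + a)%R]; last by rewrite cardfs1.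
  apply/fsubsetP => s; rewrite !inE => /orP[] /imfsetP[x /= xX ->].
    by case: (eqVneq x a) => [->|xa]; rewrite ?eqxx ?orbT // HBS.
  by rewrite HAS //; apply: contraNneq MNA => <-.
split=> // s sS.
pose X : {fset int} := [fset (a + a)%R; (M + M)%R].
have UXS : U `\` X `<=` S.
  apply/fsubsetP => s'; rewrite !inE negb_or => /andP[/andP[sa sM]].
  move=> /orP[] /imfsetP[x /= xX e]; subst s'.
    by apply: HBS => //; apply: contraNneq sa => ->.
  by apply: HAS => //; apply: contraNneq sM => ->.
have cX : (#|` X| <= 2)%N by rewrite cardfs2; case: eqP.
have cUX : (#|` S| <= #|` U `\` X|)%N.
  have := cardfsID X U; have := fsubset_leq_card (fsubsetIr U X).
  by move=> *; lia.
have eS : U `\` X = S by apply/eqP; rewrite eqEfcard UXS.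
move: sS; rewrite -eS !inE => /andP[_ /orP[]] /imfsetP[x /= xX ->].
  by left; have -> : (a + x - a = x)%R by lia.
by right; have -> : (x + M - M = x)%R by lia.
Qed.

(** Apply the dichotomy to [x + t]: either [x] lies in [B], or [x + t - M] lies in [A], hence is at
    least [t], and [x = M]. *)
Lemma critical_subset (A B : {fset int}) (t M : int) :
    (forall x, x \in A -> (t <= x <= M)%R) -> t \in B -> M \in B ->
    (forall s, s \in restricted_sumset A B ->
      (s - t)%R \in B \/ (s - M)%R \in A) ->
  A `<=` B.
Proof.
move=> bA tB MB hS; apply/fsubsetP => x xA.
have [->//|xt] := eqVneq x t.
have [|h|h] := hS (x + t)%R _.
- by apply/restricted_sumsetP; exists x, t.
- by have -> : x = (x + t - t)%R by lia.
- have := bA _ h; have := bA _ xA => *.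
  by have -> : x = M by lia.
Qed.

Lemma critical_endpoints (A B : {fset int}) :
    (2 <= #|` A|)%N -> (2 <= #|` B|)%N ->
    #|` restricted_sumset A B| = (#|` A| + #|` B| - 3)%N ->
  A = B /\ exists t M : int,
    [/\ t \in A, M \in A, forall x, x \in A -> (t <= x <= M)%R &
        forall x y, x \in A -> y \in A -> x != y ->
          (x + y - t)%R \in A \/ (x + y - M)%R \in A].
Proof.
move=> hA hB crit.
have critC : #|` restricted_sumset B A| = (#|` B| + #|` A| - 3)%N.
  by rewrite restricted_sumsetC crit addnC.
have A0 : A != fset0 by rewrite -cardfs_gt0; lia.
have B0 : B != fset0 by rewrite -cardfs_gt0; lia.
have [t tA tmin] := @fset_int_min A A0.
have [M MB Mmax] := @fset_int_max B B0.
have [t' tB' tmin'] := @fset_int_min B B0.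
have [M' MA' Mmax'] := @fset_int_max A A0.
have [tB MA hook] := @critical_hook A B t M tA tmin MB Mmax hA hB crit.
have [tA' MB' hook'] := @critical_hook B A t' M' tB' tmin' MA' Mmax' hB hA critC.
have et : t' = t by have := tmin _ tA'; have := tmin' _ tB; lia.
have eM : M' = M by have := Mmax _ MB'; have := Mmax' _ MA; lia.
subst t' M'.
have bA x : x \in A -> (t <= x <= M)%R by move=> xA; rewrite tmin // Mmax'.
have bB x : x \in B -> (t <= x <= M)%R by move=> xB; rewrite tmin' // Mmax.
have AB : A = B.
  apply/eqP; rewrite eqEfsubset; apply/andP; split.
    exact: critical_subset bA tB MB hook.
  exact: critical_subset bB tA MA hook'.
split=> //; exists t, M; split=> // x y xA yA xy.
rewrite {1}AB; apply: hook; apply/restricted_sumsetP.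
by exists x, y; rewrite -AB.
Qed.

Lemma arith_prog_of_closed (A : {fset int}) (t M : int) :
    (5 <= #|` A|)%N -> t \in A -> M \in A ->
    (forall x, x \in A -> (t <= x <= M)%R) ->
    (forall x y, x \in A -> y \in A -> x != y ->
      (x + y - t)%R \in A \/ (x + y - M)%R \in A) ->
  exists d : int, d <> 0%R /\ A = arith_prog t d #|` A|.
Proof.
move=> hA tA MA bA closedA.
(* The bound [5 <= #|A|] enters here: four points can be removed. *)
have cD (X : {fset int}) : (#|` X| < 5)%N -> A `\` X != fset0.
  move=> cX; rewrite -cardfs_gt0.
  have := cardfsID X A; have := fsubset_leq_card (fsubsetIr A X).
  by move=> *; lia.
have [|a] := @fset_int_min (A `\ t); first by apply: cD; rewrite cardfs1.
rewrite !inE => /andP[at_ aA] amin.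
have {}amin y : y \in A -> y != t -> (a <= y)%R.
  by move=> yA yt; apply: amin; rewrite !inE yt.
have [|b] := @fset_int_min (A `\` [fset t; a]).
  by apply: cD; rewrite cardfs2; case: eqP.
rewrite !inE negb_or => /andP[/andP[bt ba] bA'] bmin.
have {}bmin y : y \in A -> y != t -> y != a -> (b <= y)%R.
  by move=> yA yt ya; apply: bmin; rewrite !inE negb_or yt ya.
have [|y] := @fset_int_max (A `\ M); first by apply: cD; rewrite cardfs1.
rewrite !inE => /andP[yM yA] ymax.
have {}ymax z : z \in A -> z != M -> (z <= y)%R.
  by move=> zA zM; apply: ymax; rewrite !inE zM.
(* An element other than [t], [a], [b], [M] is above [b] and at most [y]. *)
have by_ : (b < y)%R.
  have [|z] := fset0Pn _ (cD (t |` (a |` [fset b; M])) _).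
    by rewrite !cardfsU1 cardfs1; do !case: (_ \notin _).
  rewrite !inE !negb_or => /andP[/and4P[zt za zb zM] zA].
  by have := bmin _ zA zt za; have := ymax _ zA zM; lia.
(* In the other alternative [z + a - M] is an element below [a], so it is [t], and then [z + a - t]
   is [M]. *)
have succ z : z \in A -> z != t -> z != a -> z != M -> (z + a - t)%R \in A.
  move=> zA zt za zM; have [//|h] := closedA _ _ zA aA za.
  have [e|ne] := eqVneq (z + a - M)%R t; first by have -> : (z + a - t = M)%R by lia.
  by have := amin _ h ne; have := bA _ zA; lia.
have y_pred : y = (M - (a - t))%R.
  have := bA _ yA; have := bA _ aA; have := amin _ bA' bt => ? ? ?.
  have yt : y != t by lia.
  have ya : y != a by lia.
  have h := succ _ yA yt ya yM.
  by have := bA _ h; have := ymax _ h => *; lia.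
have ab := amin _ bA' bt.
(* Here [b + y - t] exceeds [M], so [b + y - M] is in [A]; it lies strictly between [t] and [b],
   hence equals [a]. *)
have b2 : b = (a + a - t)%R.
  have [|h|h] := closedA b y bA' yA _.
  - by lia.
  - by have := bA _ h; have := bA _ bA'; have := bA _ aA => *; lia.
  - have [e|ne] := eqVneq (b + y - M)%R a; first by lia.
    by have := bmin _ h _ ne; have := bA _ aA; lia.
pose d := (a - t)%R.
have d0 : (0 < d)%R by have := bA _ aA; rewrite /d => *; lia.
have step z : z \in A -> z != M -> (z + d)%R \in A.
  move=> zA zM.
  have [->|zt] := eqVneq z t; first by have -> : (t + d = a)%R by rewrite /d; lia.
  have [->|za] := eqVneq z a; first by have -> : (a + d = b)%R by rewrite /d; lia.
  by have := succ _ zA zt za zM; rewrite /d addrA.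
(* Steps of [d] stay in [A] and stop only at [M], so they hit it exactly; [n] bounds the remaining
   distance. *)
have down (n : nat) z : z \in A -> (M - z < n%:Z)%R -> exists k : nat, M = (z + k%:Z * d)%R.
  elim: n z => [|n IH] z zA lt; first by have := bA _ zA; lia.
  have [->|zM] := eqVneq z M; first by exists 0%N; lia.
  have [|k ->] := IH _ (step _ zA zM); first by lia.
  by exists k.+1; lia.
have [n Mn] : exists n : nat, M = (t + n%:Z * d)%R.
  by apply: (down `|M - t|.+1%N) => //; lia.
have up (k : nat) : (k <= n)%N -> (t + k%:Z * d)%R \in A.
  elim: k => [|k IH] kn; first by rewrite mul0r addr0.
  have -> : (t + k.+1%:Z * d = t + k%:Z * d + d)%R by lia.
  by apply: step; [apply: IH; lia | apply/eqP; rewrite Mn; nia].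
(* An element [k] steps before [M] has index [n - k]. *)
have eA : A = arith_prog t d n.+1.
  apply/fsetP => z; apply/idP/arith_progP; last by move=> [k kn ->]; apply: up.
  move=> zA; have [|k Mk] := down `|M - z|.+1%N _ zA; first by lia.
  have := bA _ zA => bz.
  have kn : (k <= n)%N by nia.
  by exists (n - k)%N; [lia | nia].
exists d; split; first by lia.
by rewrite {2}eA card_arith_prog //; lia.
Qed.

Theorem theorem4 (A B : {fset int})
    (hA : (5 <= #|` A|)%N) (hB : (2 <= #|` B|)%N) :
  #|` restricted_sumset A B| = (#|` A| + #|` B| - 3)%N <->
  (A = B /\ exists t d : int, d <> 0%R /\ A = arith_prog t d #|` A|).
Proof.
split=> [/(critical_endpoints _ _ (ltnW (ltnW (ltnW hA))) hB)[AB [t [M [tA MA bA closedA]]]]|].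
  split=> //; exists t.
  exact: arith_prog_of_closed closedA.
move=> [<- [t [d [d0 ->]]]].
by rewrite restricted_sumset_arith_prog ?card_arith_prog //; lia.
Qed.
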